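(* For the codifferential category structure on $\mathbb{R}\text{-}\mathrm{Vec}$ induced by the free $C^\infty$-ring monad $\mathsf{S}^\infty$, $\mathsf{S}^\infty$-derivations and $C^\infty$-derivations are in bijective correspondence. That is, let $(A,\nu)$ be an $\mathsf{S}^\infty$-algebra, let $(A,\Phi)$ be the corresponding $C^\infty$-ring, and let $M$ be a module over the underlying commutative $\mathbb{R}$-algebra of $A$; then a map $A\to M$ is an $\mathsf{S}^\infty$-derivation if and only if it is a $C^\infty$-derivation.
   Context: Conventions: composition in diagrammatic order ($fg$ means first $f$, then $g$); associators and unitors suppressed. $\mathbb{R}\text{-}\mathrm{Vec}$ is the category of real vector spaces with its usual tensor product. $C^\infty$-rings: a $C^\infty$-ring $(X,\Phi)$ is a set $X$ with an operation $\Phi_f:X^m\to X$ for each smooth $f:\mathbb{R}^m\to\mathbb{R}$, $m\in\mathbb{N}$, such that $\Phi_{\pi_i}$ is the $i$-th projection and $\Phi_{g\circ\langle f_1,\dots,f_m\rangle}=\Phi_g\circ\langle\Phi_{f_1},\dots,\Phi_{f_m}\rangle$; morphisms preserve all operations. Each $C^\infty$-ring has an underlying commutative $\mathbb{R}$-algebra (from the operations given by polynomials). The forgetful functor from $C^\infty$-rings to $\mathbb{R}\text{-}\mathrm{Vec}$ has a left adjoint and is strictly monadic (the comparison functor to the category of algebras is an isomorphism); $\mathsf{S}^\infty=(S^\infty,\mu,\eta)$ is the induced monad, so $\mathsf{S}^\infty$-algebras $(A,\nu:S^\infty(A)\to A)$ are identified with $C^\infty$-rings $(A,\Phi)$. The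 monad is finitary. $\mathsf{m}_V,\mathsf{u}_V$ are the multiplication and unit of the $\mathbb{R}$-algebra underlying $S^\infty(V)$. One has $S^\infty(\mathbb{R}^n)=C^\infty(\mathbb{R}^n)$ with operations $\Phi_g(f_1,\dots,f_m)=g\circ\langle f_1,\dots,f_m\rangle$, $\eta_{\mathbb{R}^n}(e_i)=\pi_i$, and $S^\infty(h)(g)=g\circ h^*$ for linear $h:\mathbb{R}^n\to\mathbb{R}^m$ with transpose $h^*$. The deriving transformation $\mathsf{d}:S^\infty(-)\Rightarrow S^\infty(-)\otimes(-)$ is the unique natural transformation with $\mathsf{d}_{\mathbb{R}^n}(f)=\sum_{i=1}^n\frac{\partial f}{\partial x_i}\otimes e_i$ for all $n$ and $f\in C^\infty(\mathbb{R}^n)$ (natural transformations between finitary endofunctors of $\mathbb{R}\text{-}\mathrm{Vec}$ are determined by, and extend uniquely from, their restrictions to the full subcategory on the spaces $\mathbb{R}^n$). For an $\mathsf{S}^\infty$-algebra $(A,\nu)$, $A$ is a commutative monoid in $\mathbb{R}\text{-}\mathrm{Vec}$ with multiplication $\mathsf{m}^\nu=(\eta_A\otimes\eta_A)\mathsf{m}_A\nu$ and unit $\mathsf{u}^\nu=\mathsf{u}_A\nu$; this is the $\mathbb{R}$-algebra underlying the corresponding $C^\infty$-ring. $\mathsf{S}^\infty$-derivation: given an $\mathsf{S}^\infty$-algebra $(A,\nu)$ and an $(A,\mathsf{m}^\nu,\mathsf{u}^\nu)$-module $(M,\alpha:A\otimes M\to M)$, a linear map $\partial:A\to M$ with $\nu\,\partial=\mathsf{d}_A(\nu\otimes\partial)\alpha$.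 $C^\infty$-derivation: given a $C^\infty$-ring $(A,\Phi)$ and an $A$-module $M$ (over the underlying ring of $A$), a map $\mathsf{D}:A\to M$ such that for each smooth $f:\mathbb{R}^n\to\mathbb{R}$ and all $a_1,\dots,a_n\in A$, $$\mathsf{D}(\Phi_f(a_1,\dots,a_n))=\sum_{i=1}^n\Phi_{\frac{\partial f}{\partial x_i}}(a_1,\dots,a_n)\cdot\mathsf{D}(a_i).$$ *)

(* Defs.v *)
From HB Require Import structures.
From mathcomp Require Import all_boot all_order all_algebra.
From mathcomp Require Import ring generic_quotient.
From mathcomp Require Import all_classical reals topology normedtype derive realfun.
Set Implicit Arguments.
Unset Strict Implicit.
Unset Printing Implicit Defensive.
Import Order.TTheory GRing.Theory Num.Theory numFieldNormedType.Exports.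
Local Open Scope classical_set_scope.
Local Open Scope quotient_scope.
Local Open Scope ring_scope.

Section Smooth.
Context {R : realType}.

Definition basis_row n (i : 'I_n) : 'rV[R]_n := delta_mx 0 i.

Definition partial n (i : 'I_n) (f : 'rV[R]_n -> R) : 'rV[R]_n -> R :=
  fun x => 'D_(basis_row i) f x.

Definition iter_partial n (s : seq 'I_n) (f : 'rV[R]_n -> R) :=
  foldr (@partial n) f s.

(* Every iterated partial derivative exists everywhere and is continuous. *)
Definition smooth n (f : 'rV[R]_n -> R) : Prop :=
  forall s : seq 'I_n, continuous (iter_partial s f) /\
    forall i x, derivable (iter_partial s f) x (basis_row i).

Lemma smooth_partial n (i : 'I_n) f : smooth f -> smooth (partial i f).
Proof.
by move=> sf s; have := sf (rcons s i); rewrite /iter_partial foldr_rcons.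
Qed.

Lemma smooth_continuous n (f : 'rV[R]_n -> R) : smooth f -> continuous f.
Proof. by move=> /(_ [::]) []. Qed.

Lemma smooth_derivable n (f : 'rV[R]_n -> R) : smooth f ->
  forall i x, derivable f x (basis_row i).
Proof. by move=> /(_ [::]) []. Qed.

Lemma smooth_coind n (K : ('rV[R]_n -> R) -> Prop) :
  (forall f, K f -> [/\ continuous f, forall i x, derivable f x (basis_row i)
                      & forall i, K (partial i f)]) ->
  forall f, K f -> smooth f.
Proof.
move=> HK f Kf s; suff /HK [? ? _] : K (iter_partial s f) by [].
by elim: s => //= i s /HK [].
Qed.

Lemma cvg_row m (T : Type) (F : set_system T) (FF : ProperFilter F)
    (f : T -> 'rV[R]_m) (l : 'rV[R]_m) :
  (forall j, f t 0 j @[t --> F] --> l 0 j) -> f @ F --> l.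
Proof.
move=> fl; apply/cvgrPdist_le => /= e e0.
near=> x.
rewrite /Num.Def.normr/= mx_normrE (bigmax_le _ (ltW e0))//= => -[i j] _.
rewrite !mxE/= (ord1 i).
move: j; near: x; apply: filter_forall => /= j.
exact: ((cvgrPdist_le _ _).1 (fl j)).
Unshelve. all: by end_near. Qed.

Lemma mvt0 (phi dphi : R -> R) (t : R) :
  (forall s : R, is_derive s (1 : R) phi (dphi s)) ->
  exists2 c, `|c| <= `|t| & phi t - phi 0 = t * dphi c.
Proof.
move=> Hphi.
have cphi (a b : R) : {within `[a, b]%classic, continuous phi}.
  by apply: derivable_within_continuous => x _; exact: ex_derive.
have [t0|t0] := leP 0 t.
  have [c] := MVT_segment t0 (fun x _ => Hphi x) (cphi _ _).
  rewrite in_itv /= subr0 => /andP[c0 ct] ->; exists c; last by rewrite mulrC.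
  by rewrite !ger0_norm.
have [c] := MVT_segment (ltW t0) (fun x _ => Hphi x) (cphi _ _).
rewrite in_itv /= sub0r => /andP[c0 ct] E; exists c.
  by rewrite (ler0_norm ct) (ltr0_norm t0) lerN2.
by rewrite -opprB E mulrN opprK mulrC.
Qed.

Lemma partial_line n (f : 'rV[R]_n -> R) (i : 'I_n) (z : 'rV[R]_n) :
  (forall x, derivable f x (basis_row i)) ->
  forall s : R, is_derive s (1 : R) (fun t : R => f (z + t *: basis_row i))
     (partial i f (z + s *: basis_row i)).
Proof.
move=> df s.
have E : (fun h : R => h^-1 *: (((fun t : R => f (z + t *: basis_row i)) \o shift s)
      (h *: 1) - f (z + s *: basis_row i))) =
  (fun h : R => h^-1 *: ((f \o shift (z + s *: basis_row i))
      (h *: basis_row i) - f (z + s *: basis_row i))).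
  apply/funext => h /=; congr (_ *: (f _ - _)).
  by rewrite (_ : h *: 1 = h) ?scalerDl 1?addrCA //; exact: mulr1.
split; first by rewrite /derivable /= E; exact: df.
by rewrite /derive /= E.
Qed.

Lemma mvt_row n (f : 'rV[R]_n -> R) :
  (forall i x, derivable f x (basis_row i)) ->
  forall y h : 'rV[R]_n, exists xi : 'I_n -> 'rV[R]_n,
    (forall k, `|y - xi k| <= `|h|) /\
    f (y + h) - f y = \sum_k h 0 k * partial k f (xi k).
Proof.
move=> df y h.
pose tr k : 'rV[R]_n := \row_j (if (j < k)%N then h 0 j else 0).
have trS (k : 'I_n) : tr k.+1 = tr k + h 0 k *: basis_row k.
  apply/rowP => j; rewrite !mxE eqxx /= ltnS leq_eqVlt.
  have [->|jk] := eqVneq j k; first by rewrite eqxx ltnn add0r mulr1.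
  by rewrite -val_eqE /= in jk; rewrite (negbTE jk) mulr0 addr0.
have step (k : 'I_n) : exists xi : 'rV[R]_n, `|y - xi| <= `|h| /\
    f (y + tr k.+1) - f (y + tr k) = h 0 k * partial k f xi.
  have [c ck] := mvt0 (h 0 k) (partial_line (y + tr k) (df k)).
  rewrite scale0r addr0 trS addrA => ->; eexists; split; last by [].
  rewrite -addrA opprD addNKr normrN.
  rewrite [leLHS]/Num.Def.normr/= mx_normrE (bigmax_le _ (normr_ge0 _))//= => -[i j] _.
  rewrite !mxE/= (ord1 i).
  have hj : `|h 0 j| <= `|h|.
    by rewrite [leRHS]/Num.Def.normr/= mx_normrE; exact: (le_bigmax _ _ (0, j)).
  have [->|jk] := eqVneq j k.
    rewrite eqxx ltnn add0r mulr1; apply: le_trans ck _.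
    by rewrite [leRHS]/Num.Def.normr/= mx_normrE; exact: (le_bigmax _ _ (0, k)).
  by rewrite mulr0 addr0; case: ifP => // _; rewrite normr0.
have [xi Hxi] := choice step; exists xi; split=> [k|]; first by have [] := Hxi k.
transitivity (\sum_(k < n) (f (y + tr k.+1) - f (y + tr k))); last first.
  by apply: eq_bigr => k _; have [] := Hxi k.
rewrite -(big_mkord xpredT (fun k => f (y + tr k.+1) - f (y + tr k))).
rewrite telescope_sumr //; congr (f (y + _) - f _).
  by apply/rowP => j; rewrite mxE ltn_ord.
by rewrite -[LHS]addr0; congr (_ + _); apply/rowP => j; rewrite !mxE.
Qed.

Definition comp_row m n (g : 'rV[R]_m -> R) (f : 'I_m -> 'rV[R]_n -> R) :
  'rV[R]_n -> R := fun x => g (\row_j f j x).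

Lemma continuous_row m n (f : 'I_m -> 'rV[R]_n -> R) :
  (forall j, continuous (f j)) -> continuous (fun x => \row_j f j x).
Proof.
move=> cf x; apply: (@cvg_row _ _ (nbhs x)) => j.
rewrite mxE (_ : (fun t => _) = f j); first exact: cf.
by apply/funext => t; rewrite mxE.
Qed.

Lemma comp_row_continuous m n (g : 'rV[R]_m -> R) (f : 'I_m -> 'rV[R]_n -> R) :
  continuous g -> (forall j, continuous (f j)) -> continuous (comp_row g f).
Proof.
move=> cg cf x; apply: (@continuous_comp _ _ _ (fun x => \row_j f j x) g).
  exact: continuous_row.
exact: cg.
Qed.

Lemma is_derive_comp_row m n (g : 'rV[R]_m -> R) (f : 'I_m -> 'rV[R]_n -> R)
    (x v : 'rV[R]_n) (df : 'I_m -> R) :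
  (forall i y, derivable g y (basis_row i)) ->
  (forall i, continuous (partial i g)) ->
  (forall j, continuous (f j)) ->
  (forall j, is_derive x v (f j) (df j)) ->
  is_derive x v (comp_row g f) (\sum_j partial j g (\row_j f j x) * df j).
Proof.
move=> dg cdg cf Hdf.
suff H : h^-1 *: ((comp_row g f \o shift x) (h *: v) - comp_row g f x) @[h --> 0^']
    --> \sum_j partial j g (\row_j f j x) * df j.
  split; first by apply/cvg_ex; eexists; exact: H.
  exact/cvg_lim.
pose F := fun y => \row_j f j y : 'rV[R]_m.
have shx : h *: v + x @[h --> (0:R)^'] --> x.
  rewrite -[X in _ --> X]add0r -[X in X + _](scale0r v).
  apply: cvg_within_filter.
  apply: cvgD; last exact: cvg_cst.
  by apply: cvgZr_tmp; exact: cvg_id.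
have [xi Hxi] := choice (fun h : R => mvt_row dg (F x) (F (h *: v + x) - F x)).
have -> : (fun h : R => h^-1 *: ((comp_row g f \o shift x) (h *: v) - comp_row g f x))
   = (fun h : R => \sum_k partial k g (xi h k) *
        (h^-1 *: ((f k \o shift x) (h *: v) - f k x))).
  apply/funext => h; rewrite /comp_row /=.
  have [_] := Hxi h; rewrite [F x + _]addrC subrK -/(F _) -/(F _) => ->.
  rewrite scaler_sumr; apply: eq_bigr => k _.
  by rewrite !mxE scalerAl mulrC; congr (_ * _).
apply: cvg_big => [|k _]; first exact: add_continuous.
apply: cvgM.
  apply: (@cvg_comp _ _ _ (fun h => xi h k) (partial k g) _ (nbhs (F x)));
    last exact: cdg.
  have FF : F (h *: v + x) @[h --> (0:R)^'] --> F x.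
    by apply: (cvg_comp _ _ shx); exact: continuous_row.
  apply/cvgrPdist_le => /= e e0.
  near=> h; have [/(_ k) xih _] := Hxi h; apply: le_trans xih _.
  rewrite distrC; near: h.
  exact: ((cvgrPdist_le _ _).1 FF).
have [dk <-] := Hdf k; exact: dk.
Unshelve. all: by end_near. Qed.


(* Used only to show that smooth functions are closed under the operations
   below: this closure is stable under partial derivatives. *)
Inductive smooth_closure n : ('rV[R]_n -> R) -> Prop :=
| SmoothBase f of smooth f : smooth_closure f
| SmoothCst c : smooth_closure (fun=> c)
| SmoothCoord i : smooth_closure (fun x => x 0 i)
| SmoothComp m (g : 'rV[R]_m -> R) f of smooth g & (forall j, smooth (f j)) :
    smooth_closure (comp_row g f)
| SmoothAdd f g of smooth_closure f & smooth_closure g :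
    smooth_closure (fun x => f x + g x)
| SmoothMul f g of smooth_closure f & smooth_closure g :
    smooth_closure (fun x => f x * g x).

Lemma smooth_closureP n (f : 'rV[R]_n -> R) : smooth_closure f -> smooth f.
Proof.
apply: smooth_coind => {}f; elim=> {f}.
- move=> f sf; split; first exact: smooth_continuous.
    exact: smooth_derivable.
  by move=> i; constructor; exact: smooth_partial.
- move=> c; split; first exact: cst_continuous.
    by move=> i x; exact: derivable_cst.
  move=> i; rewrite (_ : partial _ _ = fun=> 0); first exact: SmoothCst.
  by apply/funext => x; rewrite /partial derive_cst.
- move=> i; have D j x : is_derive x (basis_row j)
      (fun y : 'rV[R]_n => y 0 i) (basis_row j 0 i).
    have cv : h^-1 *: (((fun y : 'rV[R]_n => y 0 i) \o shift x) (h *: basis_row j)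
        - x 0 i) @[h --> (0:R)^'] --> (basis_row j 0 i : R).
      apply: (cvg_near_cst (basis_row j 0 i : R)); near=> h.
      rewrite /= !mxE addrK; apply: mulKf.
      by near: h; exact: nbhs_dnbhs_neq.
    split; first by apply/cvg_ex; eexists; exact: cv.
    exact/cvg_lim.
  split; first exact: coord_continuous.
    by move=> j x; have [] := D j x.
  move=> j; rewrite (_ : partial _ _ = fun=> basis_row j 0 i); first exact: SmoothCst.
  by apply/funext => x; rewrite /partial derive_val.
- move=> m g f sg sf.
  have D i x : is_derive x (basis_row i) (comp_row g f)
      (\sum_j partial j g (\row_j f j x) * partial i (f j) x).
    apply: is_derive_comp_row.
    - exact: smooth_derivable.
    - by move=> j; apply/smooth_continuous/smooth_partial.
    - by move=> j; exact: smooth_continuous.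
    - by move=> j; split=> //; exact: smooth_derivable.
  split; first by apply: comp_row_continuous => [|j]; exact: smooth_continuous.
    by move=> i x; have [] := D i x.
  move=> i; rewrite (_ : partial _ _ = fun x =>
      \sum_j comp_row (partial j g) f x * partial i (f j) x); last first.
    by apply/funext => x; rewrite {1}/partial derive_val.
  elim: (index_enum _) => [|j r IH].
    by under eq_fun do rewrite big_nil; exact: SmoothCst.
  under eq_fun do rewrite big_cons; apply: SmoothAdd IH; apply: SmoothMul.
    by apply: SmoothComp => //; exact: smooth_partial.
  by apply: SmoothBase; exact: smooth_partial.
- move=> f g Kf [cf df pf] Kg [cg dg pg]; split.
  + by move=> x; exact: (continuousD (cf x) (cg x)).
  + by move=> i x; exact: derivableD.
  + move=> i; rewrite (_ : partial _ _ = fun x => partial i f x + partial i g x).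
      exact: SmoothAdd.
    by apply/funext => x; rewrite /partial deriveD.
- move=> f g Kf [cf df pf] Kg [cg dg pg]; split.
  + by move=> x; exact: (continuousM (cf x) (cg x)).
  + by move=> i x; exact: derivableM.
  + move=> i; rewrite (_ : partial _ _ = fun x =>
      f x * partial i g x + g x * partial i f x).
      by apply: SmoothAdd; apply: SmoothMul.
    by apply/funext => x; rewrite /partial deriveM.
Unshelve. all: by end_near. Qed.

End Smooth.

Record sfun (R : realType) n :=
  Sfun { sfun_val :> 'rV[R]_n -> R; sfun_smooth : smooth sfun_val }.

Lemma sfunP (R : realType) n (f g : sfun R n) : f =1 g -> f = g.
Proof.
case: f g => f sf [g sg] /= /funext fg; case: _ / fg sg => sg.
by congr Sfun; exact: Prop_irrelevance.
Qed.

Section SmoothOps.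
Context {R : realType}.

Definition sproj n (i : 'I_n) : sfun R n :=
  Sfun (smooth_closureP (SmoothCoord i)).
Definition scst n (c : R) : sfun R n := Sfun (smooth_closureP (SmoothCst n c)).
Definition sadd n (f g : sfun R n) : sfun R n := Sfun (smooth_closureP
  (SmoothAdd (SmoothBase (sfun_smooth f)) (SmoothBase (sfun_smooth g)))).
Definition smul n (f g : sfun R n) : sfun R n := Sfun (smooth_closureP
  (SmoothMul (SmoothBase (sfun_smooth f)) (SmoothBase (sfun_smooth g)))).
Definition scomp m n (g : sfun R m) (f : 'I_m -> sfun R n) : sfun R n :=
  Sfun (smooth_closureP
    (SmoothComp (sfun_smooth g) (fun j => sfun_smooth (f j)))).
Definition spartial n (i : 'I_n) (f : sfun R n) : sfun R n :=
  Sfun (smooth_partial i (sfun_smooth f)).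

End SmoothOps.

(* Composition of tuples [<f_1, .., f_m>] is encoded in [scomp] (see [comp_row]):
   [scomp g f] is [x |-> g (f_1 x, .., f_m x)]. *)
Record cinfRing (R : realType) := CinfRing {
  cinf_car :> Type;
  cinf_op : forall n, sfun R n -> ('I_n -> cinf_car) -> cinf_car;
  cinf_op_proj : forall n (i : 'I_n) a, cinf_op (sproj i) a = a i;
  cinf_op_comp : forall m n (g : sfun R m) (f : 'I_m -> sfun R n) a,
    cinf_op (scomp g f) a = cinf_op g (fun j => cinf_op (f j) a) }.

Arguments cinf_op {R c n} f a : simpl never.

Section UnderlyingAlgebra.
Context {R : realType} (B : cinfRing R).
Implicit Types (a b c : B) (r : R).

HB.instance Definition _ := gen_eqMixin (cinf_car B).
HB.instance Definition _ := gen_choiceMixin (cinf_car B).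

(* The underlying commutative R-algebra: its operations are those given by the
   polynomials 0, 1, x + y, x * y and r x.  The ring may be trivial, so it is a
   comPzRingType and an lmodType (with [cinf_scaleAl]) rather than a
   comAlgType. *)
Definition cinf_zero : B := cinf_op (scst 0 0) (tnth [tuple]).
Definition cinf_one : B := cinf_op (scst 0 1) (tnth [tuple]).
Definition cinf_add a b : B :=
  cinf_op (sadd (sproj ord0) (sproj ord_max)) (tnth [tuple a; b]).
Definition cinf_mul a b : B :=
  cinf_op (smul (sproj ord0) (sproj ord_max)) (tnth [tuple a; b]).
Definition cinf_scale r a : B :=
  cinf_op (smul (scst 1 r) (sproj ord0)) (tnth [tuple a]).
Definition cinf_opp a : B := cinf_scale (-1) a.

Lemma cinf_op_tuple m n (g : sfun R m) (f : m.-tuple (sfun R n)) (e : 'I_n -> B) :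
  cinf_op g (tnth (map_tuple (fun h => cinf_op h e) f)) =
  cinf_op (scomp g (tnth f)) e.
Proof.
by rewrite cinf_op_comp; congr cinf_op; apply/funext => j; rewrite tnth_map.
Qed.

Section Env.
Context n (e : 'I_n -> B).

Lemma cinf_zeroE : cinf_zero = cinf_op (scst n 0) e.
Proof.
rewrite (_ : scst n 0 = scomp (scst 0 0) (tnth [tuple])); last exact: sfunP.
by rewrite cinf_op_comp; congr cinf_op; apply/funext => -[].
Qed.

Lemma cinf_oneE : cinf_one = cinf_op (scst n 1) e.
Proof.
rewrite (_ : scst n 1 = scomp (scst 0 1) (tnth [tuple])); last exact: sfunP.
by rewrite cinf_op_comp; congr cinf_op; apply/funext => -[].
Qed.

Lemma cinf_addE f g :
  cinf_add (cinf_op f e) (cinf_op g e) = cinf_op (sadd f g) e.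
Proof.
rewrite /cinf_add (_ : [tuple _; _] =
  map_tuple (fun h => cinf_op h e) [tuple f; g]); last exact: val_inj.
rewrite cinf_op_tuple; congr cinf_op; apply: sfunP => x.
by rewrite /= /comp_row !mxE.
Qed.

Lemma cinf_mulE f g :
  cinf_mul (cinf_op f e) (cinf_op g e) = cinf_op (smul f g) e.
Proof.
rewrite /cinf_mul (_ : [tuple _; _] =
  map_tuple (fun h => cinf_op h e) [tuple f; g]); last exact: val_inj.
rewrite cinf_op_tuple; congr cinf_op; apply: sfunP => x.
by rewrite /= /comp_row !mxE.
Qed.

Lemma cinf_scaleE r f :
  cinf_scale r (cinf_op f e) = cinf_op (smul (scst n r) f) e.
Proof.
rewrite /cinf_scale (_ : [tuple _] =
  map_tuple (fun h => cinf_op h e) [tuple f]); last exact: val_inj.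
rewrite cinf_op_tuple; congr cinf_op; apply: sfunP => x.
by rewrite /= /comp_row !mxE.
Qed.

Definition cinf_opE :=
  (cinf_zeroE, cinf_oneE, cinf_addE, cinf_mulE, cinf_scaleE).
End Env.

Lemma cinf_env a b c : exists e : 'I_3 -> B,
  [/\ a = cinf_op (sproj ord0) e, b = cinf_op (sproj (lift ord0 ord0)) e
    & c = cinf_op (sproj ord_max) e].
Proof. by exists (tnth [tuple a; b; c]); rewrite !cinf_op_proj. Qed.

Local Ltac cinf_ring a b c :=
  let e := fresh in let ea := fresh in let eb := fresh in let ec := fresh in
  have [e [ea eb ec]] := cinf_env a b c;
  rewrite ?ea ?eb ?ec ?/cinf_opp ?(cinf_zeroE e, cinf_oneE e)
    ?(cinf_addE, cinf_mulE, cinf_scaleE);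
  congr cinf_op; apply: sfunP => ? /=; ring.

Lemma cinf_addA : associative cinf_add.
Proof. by move=> a b c; cinf_ring a b c. Qed.
Lemma cinf_addC : commutative cinf_add.
Proof. by move=> a b; cinf_ring a b a. Qed.
Lemma cinf_add0 : left_id cinf_zero cinf_add.
Proof. by move=> a; cinf_ring a a a. Qed.
Lemma cinf_addN : left_inverse cinf_zero cinf_opp cinf_add.
Proof. by move=> a; cinf_ring a a a. Qed.
Lemma cinf_mulA : associative cinf_mul.
Proof. by move=> a b c; cinf_ring a b c. Qed.
Lemma cinf_mulC : commutative cinf_mul.
Proof. by move=> a b; cinf_ring a b a. Qed.
Lemma cinf_mul1 : left_id cinf_one cinf_mul.
Proof. by move=> a; cinf_ring a a a. Qed.
Lemma cinf_mulD : left_distributive cinf_mul cinf_add.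
Proof. by move=> a b c; cinf_ring a b c. Qed.

HB.instance Definition _ := GRing.isZmodule.Build (cinf_car B)
  cinf_addA cinf_addC cinf_add0 cinf_addN.
HB.instance Definition _ := GRing.Zmodule_isComPzRing.Build (cinf_car B)
  cinf_mulA cinf_mulC cinf_mul1 cinf_mulD.

Lemma cinf_scaleA r s a : cinf_scale r (cinf_scale s a) = cinf_scale (r * s) a.
Proof. by cinf_ring a a a. Qed.
Lemma cinf_scale1 : left_id 1 cinf_scale.
Proof. by move=> a; cinf_ring a a a. Qed.
Lemma cinf_scaleDr : right_distributive cinf_scale +%R.
Proof.
by move=> r a b; rewrite /GRing.add /=; cinf_ring a b a.
Qed.
Lemma cinf_scaleDl a : {morph cinf_scale^~ a : r s / r + s}.
Proof.
by move=> r s; rewrite -[RHS]/(cinf_add _ _); cinf_ring a a a.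
Qed.

HB.instance Definition _ := GRing.Zmodule_isLmodule.Build R (cinf_car B)
  cinf_scaleA cinf_scale1 cinf_scaleDr cinf_scaleDl.

Lemma cinf_scaleAl r a b : r *: (a * b) = (r *: a) * b.
Proof.
rewrite -[LHS]/(cinf_scale r (cinf_mul a b)).
rewrite -[RHS]/(cinf_mul (cinf_scale r a) b).
cinf_ring a b a.
Qed.

End UnderlyingAlgebra.

(* The forgetful functor from C^oo-rings to real vector spaces. *)
Definition cinf_vect (R : realType) (B : cinfRing R) : lmodType R :=
  GRing.Lmodule.clone R (cinf_car B) _.

Definition cinf_morphism (R : realType) (B C : cinfRing R) (phi : B -> C) :=
  forall n (f : sfun R n) (a : 'I_n -> B),
    phi (cinf_op f a) = cinf_op f (fun i => phi (a i)).

Lemma cinf_morphism_linear (R : realType) (B C : cinfRing R) (phi : B -> C) :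
  cinf_morphism phi -> linear phi.
Proof.
move=> Hphi.
have phi2 f a b : phi (cinf_op f (tnth [tuple a; b])) =
    cinf_op f (tnth [tuple phi a; phi b]).
  rewrite Hphi; congr cinf_op; apply/funext => j.
  rewrite -(tnth_map phi); congr tnth; exact: val_inj.
have phi1 f a : phi (cinf_op f (tnth [tuple a])) = cinf_op f (tnth [tuple phi a]).
  rewrite Hphi; congr cinf_op; apply/funext => j.
  rewrite -(tnth_map phi); congr tnth; exact: val_inj.
by move=> r a b; rewrite [LHS]phi2; congr (_ + _); exact: phi1.
Qed.

(* The tensor product of real vector spaces, as formal sums of pairs modulo
   having the same image under every bilinear map; [tlift], [tliftE] and
   [tensor_ext] are its universal property.  Scalars can be absorbed in the
   first components, so the formal sums carry no coefficients. *)
Section TensorProduct.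
Context {R : realType}.

Section Construction.
Variables V W : lmodType R.
Implicit Types s t : seq (V * W).

Definition fsum (U : lmodType R) (b : {bilinear V -> W -> U}) s : U :=
  \sum_(p <- s) b p.1 p.2.

Definition fsum_eqv s t : bool :=
  `[< forall (U : lmodType R) (b : {bilinear V -> W -> U}),
        fsum b s = fsum b t >].

Lemma fsum_eqv_refl : reflexive fsum_eqv.
Proof. by move=> s; apply/asboolP. Qed.
Lemma fsum_eqv_sym : symmetric fsum_eqv.
Proof. by move=> s t; apply/asboolP/asboolP => H U b; rewrite H. Qed.
Lemma fsum_eqv_trans : transitive fsum_eqv.
Proof.
by move=> t s u /asboolP st /asboolP tu; apply/asboolP => U b; rewrite st tu.
Qed.

Canonical fsum_equiv := EquivRel fsum_eqv fsum_eqv_refl fsum_eqv_sym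
  fsum_eqv_trans.

Definition tensor : Type := {eq_quot fsum_equiv}.
HB.instance Definition _ := Choice.on tensor.
HB.instance Definition _ := Quotient.on tensor.

Implicit Types x y : tensor.

Definition tens_pi s : tensor := \pi_tensor s.

Lemma tens_piP s t : (forall (U : lmodType R) (b : {bilinear V -> W -> U}),
  fsum b s = fsum b t) -> tens_pi s = tens_pi t.
Proof. by move=> H; apply/eqmodP/asboolP. Qed.

Lemma fsum_repr (U : lmodType R) (b : {bilinear V -> W -> U}) s :
  fsum b (repr (tens_pi s)) = fsum b s.
Proof.
have /eqmodP/asboolP : tens_pi (repr (tens_pi s)) = tens_pi s by exact: reprK.
exact.
Qed.

Lemma tens_reprP x y : (forall (U : lmodType R) (b : {bilinear V -> W -> U}),
  fsum b (repr x) = fsum b (repr y)) -> x = y.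
Proof. by move=> /tens_piP; rewrite /tens_pi !reprK. Qed.

Definition tens_zero : tensor := tens_pi [::].
Definition tens_add x y : tensor := tens_pi (repr x ++ repr y).
Definition tens_scale (r : R) x : tensor :=
  tens_pi [seq (r *: p.1, p.2) | p <- repr x].
Definition tens_opp x : tensor := tens_scale (-1) x.

Section Fsum.
Variables (U : lmodType R) (b : {bilinear V -> W -> U}).

Lemma fsum0 : fsum b (repr tens_zero) = 0.
Proof. by rewrite fsum_repr /fsum big_nil. Qed.
Lemma fsumD x y : fsum b (repr (tens_add x y)) = fsum b (repr x) + fsum b (repr y).
Proof. by rewrite fsum_repr /fsum big_cat. Qed.
Lemma fsumZ r x : fsum b (repr (tens_scale r x)) = r *: fsum b (repr x).
Proof.
rewrite fsum_repr /fsum big_map scaler_sumr; apply: eq_bigr => p _ /=.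
by rewrite linearZl_LR.
Qed.
Lemma fsumN x : fsum b (repr (tens_opp x)) = - fsum b (repr x).
Proof. by rewrite fsumZ scaleN1r. Qed.
End Fsum.

Lemma tens_addA : associative tens_add.
Proof. by move=> x y z; apply: tens_reprP => U b; rewrite !fsumD addrA. Qed.
Lemma tens_addC : commutative tens_add.
Proof. by move=> x y; apply: tens_reprP => U b; rewrite !fsumD addrC. Qed.
Lemma tens_add0 : left_id tens_zero tens_add.
Proof. by move=> x; apply: tens_reprP => U b; rewrite fsumD fsum0 add0r. Qed.
Lemma tens_addN : left_inverse tens_zero tens_opp tens_add.
Proof. by move=> x; apply: tens_reprP => U b; rewrite fsumD fsumN fsum0 addNr. Qed.

HB.instance Definition _ := GRing.isZmodule.Build tensor
  tens_addA tens_addC tens_add0 tens_addN.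

Lemma tens_scaleA (r s : R) x : tens_scale r (tens_scale s x) = tens_scale (r * s) x.
Proof. by apply: tens_reprP => U b; rewrite !fsumZ scalerA. Qed.
Lemma tens_scale1 : left_id 1 tens_scale.
Proof. by move=> x; apply: tens_reprP => U b; rewrite fsumZ scale1r. Qed.
Lemma tens_scaleDr : right_distributive tens_scale +%R.
Proof.
by move=> r x y; apply: tens_reprP => U b; rewrite fsumZ !fsumD !fsumZ scalerDr.
Qed.
Lemma tens_scaleDl x : {morph tens_scale^~ x : r s / r + s}.
Proof.
by move=> r s; apply: tens_reprP => U b; rewrite fsumD !fsumZ scalerDl.
Qed.

HB.instance Definition _ := GRing.Zmodule_isLmodule.Build R tensor
  tens_scaleA tens_scale1 tens_scaleDr tens_scaleDl.

Definition tens (v : V) (w : W) : tensor := tens_pi [:: (v, w)].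

Lemma fsum_tens (U : lmodType R) (b : {bilinear V -> W -> U}) v w :
  fsum b (repr (tens v w)) = b v w.
Proof. by rewrite fsum_repr /fsum big_seq1. Qed.

Lemma tens_bilinear : bilinear_for *:%R *:%R tens.
Proof.
split=> [w|v] r x y; apply: tens_reprP => U b.
  by rewrite fsumD fsumZ !fsum_tens linearPl.
by rewrite fsumD fsumZ !fsum_tens linearPr.
Qed.

HB.instance Definition _ :=
  bilinear_isBilinear.Build R V W tensor *:%R *:%R tens tens_bilinear.

Definition tlift (U : lmodType R) (b : {bilinear V -> W -> U}) (x : tensor) : U :=
  fsum b (repr x).

Lemma tlift_linear (U : lmodType R) (b : {bilinear V -> W -> U}) : linear (tlift b).
Proof. by move=> r x y; rewrite /tlift fsumD fsumZ. Qed.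

HB.instance Definition _ (U : lmodType R) (b : {bilinear V -> W -> U}) :=
  GRing.isLinear.Build R tensor U *:%R (tlift b) (tlift_linear b).

Lemma tliftE (U : lmodType R) (b : {bilinear V -> W -> U}) v w : tlift b (tens v w) = b v w.
Proof. exact: fsum_tens. Qed.

Lemma tensP (x : tensor) : x = \sum_(p <- repr x) tens p.1 p.2.
Proof.
apply: tens_reprP => U b; rewrite -[RHS]/(tlift b _) linear_sum /=.
by apply: eq_bigr => p _; rewrite tliftE.
Qed.

Lemma tensor_ext (U : lmodType R) (f g : {linear tensor -> U}) :
  (forall v w, f (tens v w) = g (tens v w)) -> f =1 g.
Proof.
by move=> fg x; rewrite (tensP x) !linear_sum; apply: eq_bigr => p _; exact: fg.
Qed.

End Construction.

Section Functoriality.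
Variables (V V' W W' : lmodType R).
Variables (f : {linear V -> V'}) (g : {linear W -> W'}).

Definition tens_map (v : V) (w : W) : tensor V' W' := tens (f v) (g w).

Lemma tens_map_bilinear : bilinear_for *:%R *:%R tens_map.
Proof.
split=> [w|v] r x y; rewrite /tens_map /=.
  by rewrite linearP linearPl.
by rewrite linearP linearPr.
Qed.

HB.instance Definition _ := bilinear_isBilinear.Build R V W (tensor V' W')
  *:%R *:%R tens_map tens_map_bilinear.

Definition tmap : {linear tensor V W -> tensor V' W'} := tlift tens_map.

Lemma tmapE v w : tmap (tens v w) = tens (f v) (g w).
Proof. exact: tliftE. Qed.

End Functoriality.
End TensorProduct.

(* The left adjoint of [cinf_vect]: terms in the C^oo operations over V, modulo
   having the same value under every linear map from V to a C^oo-ring.  The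
   universal property is [free_lift], [free_lift_morphism], [free_lift_eta] and
   [free_lift_unique]. *)
Section FreeRing.
Context {R : realType}.

Inductive cterm (V : Type) : Type :=
| CVar of V
| COp n of sfun R n & ('I_n -> cterm V).

Fixpoint ceval V (B : cinfRing R) (h : V -> B) (t : cterm V) : B :=
  match t with
  | CVar v => h v
  | COp n f args => cinf_op f (fun i => ceval h (args i))
  end.

Section Construction.
Variable V : lmodType R.
Implicit Types s t : cterm V.

HB.instance Definition _ := gen_eqMixin (cterm V).
HB.instance Definition _ := gen_choiceMixin (cterm V).

Definition cterm_eqv s t : bool :=
  `[< forall (B : cinfRing R) (h : {linear V -> cinf_vect B}),
        ceval h s = ceval h t >].

Lemma cterm_eqv_refl : reflexive cterm_eqv.
Proof. by move=> s; apply/asboolP. Qed.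
Lemma cterm_eqv_sym : symmetric cterm_eqv.
Proof. by move=> s t; apply/asboolP/asboolP => H U b; rewrite H. Qed.
Lemma cterm_eqv_trans : transitive cterm_eqv.
Proof.
by move=> t s u /asboolP st /asboolP tu; apply/asboolP => U b; rewrite st tu.
Qed.

Canonical cterm_equiv := EquivRel cterm_eqv cterm_eqv_refl cterm_eqv_sym
  cterm_eqv_trans.

Definition free_car : Type := {eq_quot cterm_equiv}.
HB.instance Definition _ := Choice.on free_car.
HB.instance Definition _ := Quotient.on free_car.

Definition free_pi t : free_car := \pi_free_car t.

Lemma free_piP s t :
  (forall (B : cinfRing R) (h : {linear V -> cinf_vect B}), ceval h s = ceval h t) ->
  free_pi s = free_pi t.
Proof. by move=> H; apply/eqmodP/asboolP. Qed.

Lemma ceval_repr (B : cinfRing R) (h : {linear V -> cinf_vect B}) t :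
  ceval h (repr (free_pi t)) = ceval h t.
Proof.
have /eqmodP/asboolP : free_pi (repr (free_pi t)) = free_pi t by exact: reprK.
exact.
Qed.

Lemma free_reprP (x y : free_car) :
  (forall (B : cinfRing R) (h : {linear V -> cinf_vect B}),
     ceval h (repr x) = ceval h (repr y)) -> x = y.
Proof. by move=> /free_piP; rewrite /free_pi !reprK. Qed.

Definition free_op n (f : sfun R n) (a : 'I_n -> free_car) : free_car :=
  free_pi (COp f (fun i => repr (a i))).

Lemma ceval_op (B : cinfRing R) (h : {linear V -> cinf_vect B}) n f a :
  ceval h (repr (@free_op n f a)) = cinf_op f (fun i => ceval h (repr (a i))).
Proof. exact: ceval_repr. Qed.

Lemma free_op_proj n (i : 'I_n) a : free_op (sproj i) a = a i.
Proof.
by apply: free_reprP => B h; rewrite ceval_op cinf_op_proj.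
Qed.

Lemma free_op_comp m n (g : sfun R m) (f : 'I_m -> sfun R n) a :
  free_op (scomp g f) a = free_op g (fun j => free_op (f j) a).
Proof.
apply: free_reprP => B h; rewrite !ceval_op cinf_op_comp; congr cinf_op.
by apply/funext => j; rewrite ceval_op.
Qed.

Definition free_cinf : cinfRing R := CinfRing free_op_proj free_op_comp.

(* The endofunctor of the monad induced by the adjunction; [eta], [Smu] and
   [Smap] below are its unit, its multiplication and its action on maps. *)
Definition Sinf : lmodType R := cinf_vect free_cinf.

Definition free_lift (B : cinfRing R) (h : {linear V -> cinf_vect B}) (x : Sinf) :
  cinf_vect B :=
  ceval h (repr x).

Lemma free_lift_morphism (B : cinfRing R) (h : {linear V -> cinf_vect B}) :
  cinf_morphism (free_lift h : free_cinf -> B).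
Proof. by move=> n f a; exact: ceval_op. Qed.

HB.instance Definition _ (B : cinfRing R) (h : {linear V -> cinf_vect B}) :=
  GRing.isLinear.Build R (Sinf) (cinf_vect B) *:%R (free_lift h)
    (cinf_morphism_linear (free_lift_morphism h)).

Definition eta (v : V) : Sinf := free_pi (CVar v).

Lemma free_lift_eta (B : cinfRing R) (h : {linear V -> cinf_vect B}) v :
  free_lift h (eta v) = h v.
Proof. exact: ceval_repr. Qed.

Lemma free_lift_ext (x y : Sinf) :
  (forall (B : cinfRing R) (h : {linear V -> cinf_vect B}),
     free_lift h x = free_lift h y) ->
  x = y.
Proof. by move=> H; apply: free_reprP => B h; exact: H. Qed.

Lemma eta_linear : linear eta.
Proof.
move=> r v w; apply: free_lift_ext => B h.
by rewrite [RHS]linearP /= !free_lift_eta linearP.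
Qed.

HB.instance Definition _ := GRing.isLinear.Build R V (Sinf) *:%R eta eta_linear.

Lemma free_lift_unique (B : cinfRing R) (h : {linear V -> cinf_vect B})
    (phi : free_cinf -> B) :
  cinf_morphism phi -> (forall v, phi (eta v) = h v) -> phi =1 free_lift h.
Proof.
move=> Hphi phi_eta x; rewrite -[x]reprK -/(free_pi _).
elim: (repr x) => [v|n f args IH]; first by rewrite phi_eta free_lift_eta.
have -> : free_pi (COp f args) = cinf_op f (fun i => free_pi (args i) : free_cinf).
  apply: free_reprP => C k; rewrite ceval_repr ceval_op /=; congr cinf_op.
  by apply/funext => i; rewrite ceval_repr.
rewrite Hphi free_lift_morphism; congr cinf_op; apply/funext => i; exact: IH.
Qed.

End Construction.

Definition Smap (V W : lmodType R) (h : {linear V -> W}) :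
  {linear Sinf V -> Sinf W} := free_lift (@eta W \o h).

Definition Smu (V : lmodType R) : {linear Sinf (Sinf V) -> Sinf V} :=
  free_lift (B := free_cinf V) idfun.

Section Multiplication.
Variable V : lmodType R.

Definition Smul (x y : Sinf V) : Sinf V :=
  (x : free_cinf V) * (y : free_cinf V).

Lemma Smul_bilinear : bilinear_for *:%R *:%R Smul.
Proof.
have H r (x y z : free_cinf V) : (r *: x + y) * z = r *: (x * z) + y * z.
  by rewrite mulrDl cinf_scaleAl.
split=> [z|z] r x y; first exact: H.
by have := H r x y z; rewrite ![_ * z]mulrC.
Qed.

HB.instance Definition _ := bilinear_isBilinear.Build R _ _ _
  *:%R *:%R Smul Smul_bilinear.

Definition Smult : {linear tensor (Sinf V) (Sinf V) -> Sinf V} := tlift Smul.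

Definition Sunit (r : R^o) : Sinf V := r *: (1 : free_cinf V).

Lemma Sunit_linear : linear Sunit.
Proof. by move=> r s t; rewrite /Sunit scalerDl scalerA. Qed.

HB.instance Definition _ := GRing.isLinear.Build R R^o (Sinf V) *:%R Sunit Sunit_linear.
End Multiplication.

(* The isomorphism of C^oo-rings from C^oo(R^n) to the free C^oo-ring on R^n,
   which sends the i-th projection to [eta e_i]; see [smooth_elt_morphism],
   [smooth_eltK] and [free_to_smoothK]. *)
Definition smooth_elt n (f : sfun R n) : Sinf 'rV[R]_n :=
  cinf_op f (fun i => eta (basis_row i) : free_cinf 'rV[R]_n).

(* Naturality, and the prescribed value on the spaces R^n.  Exactly one family
   satisfies this: see [deriving_free_deriv] and [deriving_unique]. *)
Definition deriving (d : forall V : lmodType R,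
    {linear Sinf V -> tensor (Sinf V) V}) : Prop :=
  (forall (V W : lmodType R) (h : {linear V -> W}) (x : Sinf V),
     d W (Smap h x) = tmap (Smap h) h (d V x)) /\
  (forall n (f : sfun R n), d 'rV[R]_n (smooth_elt f) =
     \sum_(i < n) tens (smooth_elt (spartial i f)) (basis_row i)).

End FreeRing.

Record Salgebra (R : realType) := SAlgebra {
  sa_car :> lmodType R;
  sa_nu : {linear Sinf sa_car -> sa_car};
  sa_unit : forall a, sa_nu (eta a) = a;
  sa_assoc : forall t, sa_nu (Smu sa_car t) = sa_nu (Smap sa_nu t) }.

Section SalgebraTheory.
Context {R : realType} (A : Salgebra R).

(* [m^nu] and [u^nu]. *)
Definition sa_m : {linear tensor A A -> A} :=
  sa_nu A \o (Smult A \o tmap (@eta R A) (@eta R A)).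

Definition sa_u : {linear R^o -> A} := sa_nu A \o @Sunit R A.

Definition sa_op n (f : sfun R n) (a : 'I_n -> A) : A :=
  sa_nu A (cinf_op f (fun i => eta (a i) : free_cinf A)).

Lemma sa_nu_op n (f : sfun R n) (t : 'I_n -> free_cinf A) :
  sa_nu A (cinf_op f t) = sa_op f (fun i => sa_nu A (t i)).
Proof.
have := sa_assoc (cinf_op f (fun i => eta (t i))).
rewrite /Smu /Smap /= !free_lift_morphism.
under [X in cinf_op f X]eq_fun do rewrite free_lift_eta /=.
move=> ->; congr (sa_nu A (cinf_op f _)).
by apply/funext => i; rewrite free_lift_eta.
Qed.

Lemma sa_op_proj n (i : 'I_n) a : sa_op (sproj i) a = a i.
Proof. by rewrite /sa_op cinf_op_proj sa_unit. Qed.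

Lemma sa_op_comp m n (g : sfun R m) (f : 'I_m -> sfun R n) a :
  sa_op (scomp g f) a = sa_op g (fun j => sa_op (f j) a).
Proof. by rewrite [LHS]/sa_op cinf_op_comp sa_nu_op. Qed.

(* The inverse of the comparison functor: by [sa_nu_op], [sa_nu A] is the
   morphism of C^oo-rings extending the identity of A, i.e. the counit at this
   C^oo-ring, so the comparison functor sends it back to (A, nu). *)
Definition cinf_of_Salgebra : cinfRing R := CinfRing sa_op_proj sa_op_comp.
End SalgebraTheory.

(* Modules over the monoid (A, m^nu, u^nu) in real vector spaces; the two axioms
   are the module diagrams evaluated on pure tensors. *)
Record Smodule (R : realType) (A : Salgebra R) := SModule {
  sm_car :> lmodType R;
  sm_act : {linear tensor A sm_car -> sm_car};
  sm_assoc : forall a b x,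
    sm_act (tens (sa_m A (tens a b)) x) = sm_act (tens a (sm_act (tens b x)));
  sm_unit : forall x, sm_act (tens (sa_u A 1) x) = x }.

Definition Sderivation (R : realType)
    (d : forall V : lmodType R, {linear Sinf V -> tensor (Sinf V) V})
    (A : Salgebra R) (M : Smodule A) (D : {linear A -> M}) : Prop :=
  forall x : Sinf A, D (sa_nu A x) = sm_act M (tmap (sa_nu A) D (d A x)).

Definition cinf_derivation (R : realType) (B : cinfRing R) (N : lmodType B)
    (D : B -> N) : Prop :=
  forall n (f : sfun R n) (a : 'I_n -> B),
    D (cinf_op f a) = \sum_(i < n) cinf_op (spartial i f) a *: D (a i).

Section ModuleConversion.
Context {R : realType} {A : Salgebra R} (M : Smodule A).

Lemma sa_mE (a b : A) :
  sa_m A (tens a b) = (a : cinf_of_Salgebra A) * (b : cinf_of_Salgebra A).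
Proof.
rewrite /sa_m /= tmapE tliftE /Smul [LHS]sa_nu_op.
congr sa_op; apply/funext => i.
rewrite -(tnth_map (sa_nu A)); congr tnth; apply: val_inj => /=.
by rewrite !sa_unit.
Qed.

Lemma sa_uE : sa_u A 1 = (1 : cinf_of_Salgebra A).
Proof.
rewrite /sa_u /= /Sunit scale1r [LHS]sa_nu_op.
by congr sa_op; apply/funext => -[].
Qed.

Lemma sa_addE (a b : A) :
  (a : cinf_of_Salgebra A) + (b : cinf_of_Salgebra A) = (a + b : A).
Proof.
rewrite -[in RHS](sa_unit a) -[in RHS](sa_unit b) -raddfD [RHS]sa_nu_op.
congr sa_op; apply/funext => i.
rewrite -(tnth_map (sa_nu A)); congr tnth; apply: val_inj => /=.
by rewrite !sa_unit.
Qed.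

(* The same abelian group, as a module over the ring underlying the C^oo-ring
   of A. *)
Definition mod_of_Smodule : Type := M.
HB.instance Definition _ := GRing.Zmodule.on mod_of_Smodule.

Definition mod_scale (a : cinf_of_Salgebra A) (x : mod_of_Smodule) :
  mod_of_Smodule := sm_act M (tens (a : A) (x : M)).

Lemma mod_scaleA a b x : mod_scale a (mod_scale b x) = mod_scale (a * b) x.
Proof. by rewrite /mod_scale -sa_mE sm_assoc. Qed.
Lemma mod_scale1 : left_id 1 mod_scale.
Proof. by move=> x; rewrite /mod_scale -sa_uE sm_unit. Qed.
Lemma mod_scaleDr : right_distributive mod_scale +%R.
Proof. by move=> a x y; rewrite /mod_scale linearDr linearD. Qed.
Lemma mod_scaleDl x : {morph mod_scale^~ x : a b / a + b}.
Proof. by move=> a b; rewrite /mod_scale sa_addE linearDl linearD. Qed.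

HB.instance Definition _ := GRing.Zmodule_isLmodule.Build (cinf_of_Salgebra A)
  mod_of_Smodule mod_scaleA mod_scale1 mod_scaleDr mod_scaleDl.
End ModuleConversion.

(* Existence and uniqueness of the deriving transformation.  Existence uses the
   square-zero extension of the free C^oo-ring on V by [tensor (Sinf V) V]. *)
Section DerivingExists.
Context {R : realType}.

Lemma spartial_proj n (i j : 'I_n) : spartial i (sproj j) = scst n (j == i)%:R :> sfun R n.
Proof.
apply: sfunP => x; rewrite /= /partial.
have cv : h^-1 *: (((fun y : 'rV[R]_n => y 0 j) \o shift x) (h *: basis_row i)
    - x 0 j) @[h --> (0:R)^'] --> ((j == i)%:R : R).
  apply: (cvg_near_cst ((j == i)%:R : R)); near=> h.
  rewrite /= !mxE addrK eqxx /=; apply: mulKf.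
  by near: h; exact: nbhs_dnbhs_neq.
exact/cvg_lim.
Unshelve. all: by end_near. Qed.

Lemma spartial_cst n (i : 'I_n) c : spartial i (scst n c) = scst n 0 :> sfun R n.
Proof. by apply: sfunP => x; rewrite /= /partial derive_cst. Qed.

Lemma spartial_add n (i : 'I_n) (f g : sfun R n) :
  spartial i (sadd f g) = sadd (spartial i f) (spartial i g).
Proof.
apply: sfunP => x; rewrite /= /partial.
by rewrite deriveD //; apply: smooth_derivable; exact: sfun_smooth.
Qed.

Lemma spartial_mul n (i : 'I_n) (f g : sfun R n) :
  spartial i (smul f g) = sadd (smul f (spartial i g)) (smul g (spartial i f)).
Proof.
apply: sfunP => x; rewrite /= /partial.
by rewrite deriveM //; apply: smooth_derivable; exact: sfun_smooth.
Qed.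

Lemma partial_comp_row m n (g : sfun R m) (f : 'I_m -> sfun R n) i x :
  partial i (comp_row g f) x =
  \sum_j comp_row (partial j g) f x * partial i (f j) x.
Proof.
have D : is_derive x (basis_row i) (comp_row g f)
   (\sum_j partial j g (\row_j f j x) * partial i (f j) x).
  apply: is_derive_comp_row.
  - exact: (smooth_derivable (sfun_smooth g)).
  - by move=> j; apply/smooth_continuous/smooth_partial/sfun_smooth.
  - by move=> j; apply/smooth_continuous/sfun_smooth.
  - by move=> j; split=> //; exact: (smooth_derivable (sfun_smooth (f j))).
by rewrite {1}/partial derive_val.
Qed.

Lemma cinf_op_cst (B : cinfRing R) n c (e : 'I_n -> B) :
  cinf_op (scst n c) e = c *: (1 : B).
Proof.
rewrite -[RHS]/(cinf_scale c (cinf_one B)) (cinf_oneE e) cinf_scaleE.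
by congr cinf_op; apply: sfunP => x; rewrite /= mulr1.
Qed.

Lemma cinf_opM (B : cinfRing R) n (f g : sfun R n) (e : 'I_n -> B) :
  cinf_op f e * cinf_op g e = cinf_op (smul f g) e.
Proof. exact: cinf_mulE. Qed.

Lemma cinf_op_sum (B : cinfRing R) n m (F : 'I_m -> sfun R n)
    (e : 'I_n -> B) (f : sfun R n) :
  (forall x, f x = \sum_j F j x) -> cinf_op f e = \sum_j cinf_op (F j) e.
Proof.
move=> fE; have -> : f = \big[@sadd R n/scst n 0]_j F j.
  apply: sfunP => x; rewrite fE.
  by rewrite (big_morph (fun h : sfun R n => h x) (id1 := 0) (op1 := +%R)).
have opD (h k : sfun R n) : cinf_op (sadd h k) e = cinf_op h e + cinf_op k e.
  by rewrite -cinf_addE.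
have op0 : cinf_op (scst n 0) e = 0 :> B by rewrite -cinf_zeroE.
exact: (big_morph (fun h : sfun R n => cinf_op h e) opD op0).
Qed.

Section SquareZero.
Variable V : lmodType R.
Local Notation S := (free_cinf V).
Local Notation N := (tensor (Sinf V) V).

Lemma smulL_linear (x : S) : linear (fun y : Sinf V => (x * (y : S) : Sinf V)).
Proof. by move=> r y z; rewrite /=; have := (@Smul_bilinear R V).2 x r y z. Qed.

Definition smulL (x : S) (y : Sinf V) : Sinf V := x * (y : S).
HB.instance Definition _ x := GRing.isLinear.Build R (Sinf V) (Sinf V) *:%R
  (smulL x) (smulL_linear x).

Definition nact (x : S) : {linear N -> N} := tmap (smulL x) idfun.

Lemma nactE x (y : S) v : nact x (tens (y : Sinf V) v) = tens (x * y : Sinf V) v.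
Proof. by rewrite /nact tmapE. Qed.

Lemma nactA x y t : nact (x * y) t = nact x (nact y t).
Proof.
apply: (@tensor_ext R _ _ _ (nact (x * y)) (nact x \o nact y)) => a v /=.
by rewrite !nactE mulrA.
Qed.

Lemma nact1 t : nact 1 t = t.
Proof.
by apply: (@tensor_ext R _ _ _ (nact 1) idfun) => a v /=; rewrite !nactE mul1r.
Qed.

Lemma nactDl x y t : nact (x + y) t = nact x t + nact y t.
Proof.
apply: (@tensor_ext R _ _ _ (nact (x + y)) (nact x \+ nact y)) => a v /=.
by rewrite !nactE mulrDl -linearDl.
Qed.

Lemma nactZl r x t : nact (r *: x) t = r *: nact x t.
Proof.
apply: (@tensor_ext R _ _ _ (nact (r *: x)) (r \*: nact x)) => a v /=.
by rewrite !nactE -cinf_scaleAl -linearZl_LR.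
Qed.

Lemma nact0 t : nact 0 t = 0.
Proof. by rewrite -(scale0r (0 : S)) nactZl scale0r. Qed.

Lemma nact_suml m (F : 'I_m -> S) t : nact (\sum_j F j) t = \sum_j nact (F j) t.
Proof. exact: (big_morph (nact^~ t) (fun x y => nactDl x y t) (nact0 t)). Qed.

Lemma nact_op_cst n c (e : 'I_n -> S) t : nact (cinf_op (scst n c) e) t = c *: t.
Proof. by rewrite cinf_op_cst nactZl nact1. Qed.

Definition sq_op n (f : sfun R n) (p : 'I_n -> S * N) : S * N :=
  (cinf_op f (fun i => (p i).1),
   \sum_i nact (cinf_op (spartial i f) (fun i => (p i).1)) (p i).2).

Lemma sq_proj n (i : 'I_n) p : sq_op (sproj i) p = p i.
Proof.
rewrite /sq_op cinf_op_proj (bigD1 i) //= big1 ?addr0 => [|j ji].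
  by rewrite spartial_proj eqxx nact_op_cst scale1r; case: (p i).
by rewrite spartial_proj eq_sym (negbTE ji) nact_op_cst scale0r.
Qed.

Lemma sq_comp m n (g : sfun R m) (f : 'I_m -> sfun R n) p :
  sq_op (scomp g f) p = sq_op g (fun j => sq_op (f j) p).
Proof.
rewrite /sq_op /= cinf_op_comp; congr pair; set e := fun i => (p i).1.
under [RHS]eq_bigr do rewrite raddf_sum.
rewrite exchange_big; apply: eq_bigr => i _ /=.
under [RHS]eq_bigr => j _ do rewrite -nactA -cinf_op_comp cinf_opM.
rewrite -nact_suml; congr (nact _ _).
rewrite (@cinf_op_sum _ _ _ (fun j => smul (scomp (spartial j g) f) (spartial i (f j)))) //.
by move=> x /=; rewrite partial_comp_row.
Qed.

Definition sq : cinfRing R := CinfRing sq_proj sq_comp.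

Lemma sq_addE (p q : sq) : p + q = (p.1 + q.1, p.2 + q.2).
Proof.
rewrite -[LHS]/(sq_op _ _); congr pair.
  rewrite -[RHS]/(cinf_op _ _); congr cinf_op; apply/funext => i.
  by rewrite -(tnth_map fst); congr tnth; exact: val_inj.
have E (i : 'I_2) : spartial i (sadd (sproj ord0) (sproj ord_max)) = scst 2 1 :> sfun R 2.
  rewrite spartial_add !spartial_proj; apply: sfunP => x /=.
  by case: i => -[|[|//]] /= ?; rewrite ?addr0 ?add0r.
by rewrite big_ord_recl big_ord1 !E !nact_op_cst !scale1r.
Qed.

Lemma sq_scaleE r (p : sq) : r *: p = (r *: p.1, r *: p.2).
Proof.
rewrite -[LHS]/(sq_op _ _); congr pair.
  rewrite -[RHS]/(cinf_op _ _); congr cinf_op; apply/funext => i.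
  by rewrite -(tnth_map fst); congr tnth; exact: val_inj.
have E (i : 'I_1) : spartial i (smul (scst 1 r) (sproj ord0)) = scst 1 r :> sfun R 1.
  rewrite spartial_mul spartial_proj spartial_cst; apply: sfunP => x /=.
  by rewrite (ord1 i) eqxx mulr0 addr0 mulr1.
by rewrite big_ord1 E nact_op_cst.
Qed.

Definition sq_eta (v : V) : cinf_vect sq := (eta v : S, tens (1 : S) v).

Lemma sq_eta_linear : linear sq_eta.
Proof.
move=> r v w; apply: (etrans _ (esym (sq_addE (r *: (sq_eta v : sq)) _))).
by rewrite sq_scaleE /sq_eta /= linearP linearPr.
Qed.

HB.instance Definition _ := GRing.isLinear.Build R V (cinf_vect sq) *:%R
  sq_eta sq_eta_linear.

Definition free_deriv (x : Sinf V) : N := (free_lift sq_eta x : sq).2.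

Lemma free_deriv_linear : linear free_deriv.
Proof.
move=> r x y; rewrite /free_deriv linearP.
rewrite -[X in X.2]/((r *: (free_lift sq_eta x : sq) + (free_lift sq_eta y : sq)) : sq).
by rewrite sq_addE sq_scaleE.
Qed.

HB.instance Definition _ := GRing.isLinear.Build R (Sinf V) N *:%R
  free_deriv free_deriv_linear.

Lemma fst_lift (x : Sinf V) : (free_lift sq_eta x : sq).1 = x.
Proof.
have H1 : cinf_morphism (fun x : S => (free_lift sq_eta x : sq).1 : S).
  by move=> n f a; rewrite free_lift_morphism.
have H2 : cinf_morphism (fun x : S => x) by [].
rewrite (free_lift_unique (h := @eta R V) H1); last by move=> v; rewrite free_lift_eta.
by rewrite -(free_lift_unique (h := @eta R V) H2).
Qed.

Lemma free_deriv_eta v : free_deriv (eta v) = tens (1 : S) v.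
Proof. by rewrite /free_deriv free_lift_eta. Qed.

Lemma free_deriv_op n (f : sfun R n) (a : 'I_n -> S) :
  free_deriv (cinf_op f a) = \sum_i nact (cinf_op (spartial i f) a)
    (free_deriv (a i)).
Proof.
rewrite /free_deriv free_lift_morphism /=; apply: eq_bigr => i _.
by congr (nact (cinf_op _ _) _); apply/funext => j; rewrite fst_lift.
Qed.

End SquareZero.

Lemma free_ind (V : lmodType R) (P : free_cinf V -> Prop) :
  (forall v, P (eta v)) ->
  (forall n (f : sfun R n) a, (forall i, P (a i)) -> P (cinf_op f a)) ->
  forall x, P x.
Proof.
move=> Pe Po x; rewrite -[x]reprK -/(free_pi _).
elim: (repr x) => [v|n f args IH]; first exact: Pe.
have -> : free_pi (COp f args) = cinf_op f (fun i => free_pi (args i) : free_cinf V).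
  apply: free_reprP => C k; rewrite ceval_repr ceval_op /=; congr cinf_op.
  by apply/funext => i; rewrite ceval_repr.
exact: Po.
Qed.

Lemma Smap_morphism (V W : lmodType R) (h : {linear V -> W}) :
  cinf_morphism (Smap h : free_cinf V -> free_cinf W).
Proof. move=> n f a; exact: free_lift_morphism. Qed.

Lemma Smap_eta (V W : lmodType R) (h : {linear V -> W}) v :
  Smap h (eta v) = eta (h v).
Proof. exact: free_lift_eta. Qed.

Lemma Smap_mul (V W : lmodType R) (h : {linear V -> W}) (x y : free_cinf V) :
  Smap h (x * y) = (Smap h x : free_cinf W) * (Smap h y : free_cinf W).
Proof.
rewrite [LHS]Smap_morphism; congr cinf_op; apply/funext => i.
by rewrite -(tnth_map (Smap h)); congr tnth; exact: val_inj.
Qed.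

Lemma nact_natural (V W : lmodType R) (h : {linear V -> W}) (y : free_cinf V) t :
  nact (Smap h y : free_cinf W) (tmap (Smap h) h t) = tmap (Smap h) h (nact y t).
Proof.
apply: (@tensor_ext R _ _ _ (nact (Smap h y : free_cinf W) \o tmap (Smap h) h)
  (tmap (Smap h) h \o nact y)) => x v.
rewrite [LHS]/= [RHS]/= !(nactE, tmapE).
by rewrite Smap_mul.
Qed.

Lemma deriving_free_deriv : deriving (fun V => @free_deriv V).
Proof.
split=> [V W h|n f].
  apply: free_ind => [v|n f a IH].
    rewrite Smap_eta /= !free_deriv_eta tmapE; congr tens.
    by rewrite [RHS]Smap_morphism; congr cinf_op; apply/funext => -[].
  rewrite Smap_morphism /= !free_deriv_op linear_sum; apply: eq_bigr => i _.
  rewrite IH -Smap_morphism.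
  exact: nact_natural.
rewrite /= free_deriv_op; apply: eq_bigr => i _.
by rewrite free_deriv_eta nactE mulr1.
Qed.

Lemma free_representation (V : lmodType R) (x : free_cinf V) :
  exists n (f : sfun R n) (v : 'I_n -> V),
    x = cinf_op f (fun i => eta (v i) : free_cinf V).
Proof.
elim/free_ind: x => [v|m g a IH].
  by exists 1, (sproj ord0), (fun=> v); rewrite cinf_op_proj.
have /choice[N] := IH => /(_ _)/cid HN.
pose f i := projT1 (HN i).
have Hf i : exists v : 'I_(N i) -> V,
    a i = cinf_op (f i) (fun k => eta (v k) : free_cinf V).
  exact: (projT2 (HN i)).
pose v i := projT1 (cid (Hf i)).
have Hv i : a i = cinf_op (f i) (fun k => eta (v i k) : free_cinf V).
  exact: (projT2 (cid (Hf i))).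
pose T := {i : 'I_m & 'I_(N i)}.
exists #|{: T}|, (scomp g (fun i => scomp (f i)
  (fun k => sproj (enum_rank (Tagged (fun i => 'I_(N i)) k : T))))).
exists (fun k => v (tag (enum_val k : T)) (tagged (enum_val k : T))).
rewrite cinf_op_comp; congr cinf_op; apply/funext => i.
rewrite cinf_op_comp Hv; congr cinf_op; apply/funext => k.
by rewrite cinf_op_proj enum_rankK.
Qed.

Definition row_comb (V : lmodType R) n (v : 'I_n -> V) (r : 'rV[R]_n) : V :=
  \sum_i r 0 i *: v i.

Lemma row_comb_linear (V : lmodType R) n (v : 'I_n -> V) : linear (row_comb v).
Proof.
move=> c x y; rewrite /row_comb scaler_sumr -big_split; apply: eq_bigr => i _.
by rewrite !mxE scalerDl scalerA.
Qed.

HB.instance Definition _ (V : lmodType R) n (v : 'I_n -> V) :=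
  GRing.isLinear.Build R 'rV[R]_n V *:%R (row_comb v) (row_comb_linear v).

Lemma row_comb_basis (V : lmodType R) n (v : 'I_n -> V) i :
  row_comb v (basis_row i) = v i.
Proof.
rewrite /row_comb (bigD1 i) //= big1 => [|j ji]; rewrite mxE eqxx ?eqxx.
  by rewrite scale1r addr0.
by rewrite (negbTE ji) scale0r.
Qed.

Lemma deriving_unique d1 d2 : deriving d1 -> deriving d2 ->
  forall (V : lmodType R) (x : Sinf V), d1 V x = d2 V x.
Proof.
move=> [nat1 d1E] [nat2 d2E] V x.
have [n [f [v ->]]] := free_representation x.
have -> : cinf_op f (fun i => eta (v i) : free_cinf V) =
    Smap (row_comb v) (smooth_elt f).
  rewrite Smap_morphism; congr cinf_op; apply/funext => i.
  by rewrite Smap_eta /= row_comb_basis.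
by rewrite nat1 nat2 d1E d2E.
Qed.


Definition smooth_ring_proj n m (i : 'I_m) (a : 'I_m -> sfun R n) :
  scomp (sproj i) a = a i.
Proof. by apply: sfunP => x; rewrite /= /comp_row mxE. Qed.

Lemma smooth_ring_comp n m k (g : sfun R m) (f : 'I_m -> sfun R k)
    (a : 'I_k -> sfun R n) :
  scomp (scomp g f) a = scomp g (fun j => scomp (f j) a).
Proof.
by apply: sfunP.
Qed.

Definition smooth_ring n : cinfRing R :=
  @CinfRing R (sfun R n) (fun m g a => scomp g a)
    (@smooth_ring_proj n) (@smooth_ring_comp n).

Lemma smooth_elt_morphism n :
  cinf_morphism (@smooth_elt R n : smooth_ring n -> free_cinf 'rV[R]_n).
Proof. by move=> m f a; rewrite /smooth_elt cinf_op_comp. Qed.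

Lemma row_sum_basis n (v : 'rV[R]_n) : v = \sum_i v 0 i *: basis_row i.
Proof. exact: row_sum_delta. Qed.

Definition coords n (i : 'I_n) : cinf_vect (smooth_ring n) := sproj i.

Definition free_to_smooth n (x : free_cinf 'rV[R]_n) : smooth_ring n :=
  free_lift (row_comb (@coords n)) x.

Lemma smooth_eltK n : cancel (@smooth_elt R n) (@free_to_smooth n).
Proof.
move=> f; rewrite /free_to_smooth /smooth_elt free_lift_morphism.
under [X in cinf_op f X]eq_fun do rewrite free_lift_eta /= row_comb_basis.
apply: sfunP => x; rewrite /= /comp_row; congr (f _).
by apply/rowP => i; rewrite mxE.
Qed.

Lemma free_to_smoothK n : cancel (@free_to_smooth n) (@smooth_elt R n).
Proof.
apply: free_ind => [v|m f a IH].
  rewrite /free_to_smooth free_lift_eta /= /row_comb.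
  pose HL := GRing.isLinear.Build R (cinf_vect (smooth_ring n)) (Sinf 'rV[R]_n)
    *:%R (@smooth_elt R n) (cinf_morphism_linear (@smooth_elt_morphism n)).
  pose L : {linear cinf_vect (smooth_ring n) -> Sinf 'rV[R]_n} :=
    HB.pack (@smooth_elt R n) HL.
  have LZ i : L (v 0 i *: coords i) = v 0 i *: eta (basis_row i).
    by rewrite linearZ; congr (_ *: _); exact: (@cinf_op_proj R (free_cinf _)).
  rewrite -[LHS]/(L _) [in RHS](row_sum_basis v) !linear_sum.
  by apply: eq_bigr => i _; rewrite LZ [RHS]linearZ.
rewrite /free_to_smooth free_lift_morphism.
rewrite [LHS]smooth_elt_morphism; congr cinf_op; apply/funext => i; exact: IH.
Qed.

End DerivingExists.

(* Main.v *)
(* Every element of [Sinf A] has the form f(eta a_1, .., eta a_n) with f smooth,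
   and naturality along R^n -> A, e_i |-> a_i, transports the formula for the
   deriving transformation from R^n to A.  On such an element the equation
   defining S^oo-derivations is the C^oo-chain rule for f at a_1, .., a_n. *)
Require Import Defs.
From HB Require Import structures.
From mathcomp Require Import all_boot all_order all_algebra.
From mathcomp Require Import all_classical reals topology normedtype derive.
Import GRing.Theory.
Local Open Scope ring_scope.

Lemma deriving_op (R : realType)
    (d : forall V : lmodType R, {linear Sinf V -> tensor (Sinf V) V})
    (d_deriving : deriving d) (V : lmodType R) n (f : sfun R n) (v : 'I_n -> V) :
  d V (cinf_op f (fun i => Defs.eta (v i) : free_cinf V)) =
  \sum_(i < n) tens (cinf_op (spartial i f)
    (fun j => Defs.eta (v j) : free_cinf V) : Sinf V) (v i).
Proof.
(* Stated for all [g]: it is used for [f] itself and then for each [spartial i f]. *)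
have Smap_elt (g : sfun R n) : Smap (row_comb v) (smooth_elt g) =
    cinf_op g (fun i => Defs.eta (v i) : free_cinf V).
  rewrite Smap_morphism; congr cinf_op; apply/funext => i.
  by rewrite Smap_eta /= row_comb_basis.
have [natd dE] := d_deriving.
rewrite -Smap_elt natd dE linear_sum; apply: eq_bigr => i _.
by rewrite tmapE Smap_elt /= row_comb_basis.
Qed.

Section Derivations.
Context {R : realType} {A : Salgebra R} {M : Smodule A}.

(** For any linear [D], this sum is the right side of the chain rule, because scaling in
    [mod_of_Smodule M] is [sm_act M] on pure tensors. *)
Lemma act_deriving (d : forall V : lmodType R, {linear Sinf V -> tensor (Sinf V) V})
    (D : {linear A -> M}) n (f : sfun R n) (a : 'I_n -> A) : deriving d ->
  sm_act M (tmap (sa_nu A) D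
    (d A (cinf_op f (fun i => Defs.eta (a i) : free_cinf A)))) =
  \sum_(i < n) sm_act M (tens (sa_op (spartial i f) a) (D (a i))).
Proof.
move=> d_deriving; rewrite deriving_op // (linear_sum (tmap (sa_nu A) D)) linear_sum.
by apply: eq_bigr => i _; rewrite /= tmapE.
Qed.

(** A constant operation is a real multiple of the unit [sa_u A 1], which acts as the identity. *)
Lemma act_cst n c (a : 'I_n -> A) (x : M) :
  sm_act M (tens (sa_op (scst n c) a) x) = c *: x.
Proof.
have -> : sa_op (scst n c) a = c *: sa_u A 1.
  by rewrite /sa_op cinf_op_cst linearZ /= /Sunit scale1r.
by rewrite linearZl_LR linearZ /= sm_unit.
Qed.

(** Linearity is the chain rule for the function sending s, t to r s + t, whose partial derivatives
    are the constants r and 1. *)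
Lemma cinf_derivation_linear (D : A -> M) :
  cinf_derivation (B := cinf_of_Salgebra A) (N := mod_of_Smodule M) D ->
  linear D.
Proof.
move=> derD r x y.
pose f : sfun R 2 := sadd (smul (scst 2 r) (sproj ord0)) (sproj ord_max).
pose a : 'I_2 -> A := tnth [tuple x; y].
have fa : sa_op f a = r *: x + y.
  rewrite /sa_op -cinf_addE -cinf_scaleE !cinf_op_proj.
  rewrite -[X in sa_nu A X]/(r *: Defs.eta x + Defs.eta y : Sinf A).
  by rewrite linearP !sa_unit.
have f0 : spartial ord0 f = scst 2 r.
  rewrite spartial_add spartial_mul !spartial_proj spartial_cst.
  by apply: sfunP => z /=; rewrite mulr1 mulr0 !addr0.
have f1 : spartial ord_max f = scst 2 1.
  rewrite spartial_add spartial_mul !spartial_proj spartial_cst.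
  by apply: sfunP => z /=; rewrite !mulr0 !add0r.
have := derD 2 f a; rewrite -[X in D X = _]/(sa_op f a) fa => ->.
rewrite big_ord_recr big_ord1 /= (_ : widen_ord _ _ = ord0); last exact: val_inj.
rewrite f0 f1.
rewrite -[LHS]/(sm_act M (tens (sa_op (scst 2 r) a) (D x)) +
  sm_act M (tens (sa_op (scst 2 1) a) (D y))).
by rewrite !act_cst scale1r.
Qed.

End Derivations.

Theorem theorem5p1p5 (R : realType)
    (d : forall V : lmodType R, {linear Sinf V -> tensor (Sinf V) V})
    (d_deriving : deriving d)
    (A : Salgebra R) (M : Smodule A) (D : A -> M) :
  (exists2 D' : {linear A -> M}, D' =1 D & Sderivation d D') <->
  cinf_derivation (B := cinf_of_Salgebra A) (N := mod_of_Smodule M) D.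
Proof.
split=> [[D' D'E derD] n f a|derD].
  (* By definition, [sa_nu A] sends this element to the operation of [f] in [cinf_of_Salgebra A] at
     [a]. *)
  have := derD (cinf_op f (fun i => Defs.eta (a i : A) : free_cinf A)).
  rewrite act_deriving // D'E => ->.
  by apply: eq_bigr => i _; rewrite D'E.
pose HL := GRing.isLinear.Build R A M *:%R D (cinf_derivation_linear D derD).
pose D' : {linear A -> M} := HB.pack D HL.
exists D' => // x.
(* Elements of this form exhaust [Sinf A], so the chain rule at [f] and [a] settles every [x]. *)
have [n [f [a ->]]] := free_representation x.
by rewrite act_deriving //; exact: derD.
Qed.
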